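(* Let $G$ be a finite group with $N=|G|$, and for each positive integer $k$ let $G_k$ be the set of elements of $G$ of order $k$ and $N_k=|G_k|$. Let $\phi$ denote Euler's totient function, $\phi(k)=|\{t\in\{1,\dots,k\}: \gcd(t,k)=1\}|$, and let $K=\{k\in\{5,\dots,N\}: \phi(k)\ge \tfrac{3k}{4}\}$. Then the number of $3$-term arithmetic progressions in $G$ equals \[ \sum_{k=4}^{N}\frac{N\cdot N_k}{2}+\frac{N\cdot N_3}{6}, \] and the minimum $R(3,G,2)$, over all colorings $\chi:G\to\{-1,1\}$, of the number of monochromatic $3$-term arithmetic progressions satisfies \[ R(3,G,2)\ \ge\ \sum_{k\in K}\frac{N\cdot N_k}{8}\Big(1-3\,\frac{k-\phi(k)}{\phi(k)}\Big). \]
   Context: A $3$-term arithmetic progression in a group $G$ is a set $\{a,\,b\cdot a,\,b\cdot b\cdot a\}$ of three distinct elements of $G$, where $a,b\in G$; it is regarded as an unordered set, so each such set is counted once. A $2$-coloring is a map $\chi:G\to\{-1,1\}$, and a progression is monochromatic if $\chi$ is constant on it. $R(3,G,2)$ is the minimum over all $2$-colorings of the number of monochromatic $3$-term arithmetic progressions. *)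

(* Defs.v *)
From mathcomp Require Import all_boot all_order all_algebra all_fingroup.

Set Implicit Arguments.
Unset Strict Implicit.
Unset Printing Implicit Defensive.

Definition ap3 (G : finGroupType) (a b : G) : {set G} :=
  [set a; (b * a)%g; (b * b * a)%g].

(* The cardinality condition says that a, ba and bba are pairwise distinct. *)
Definition AP3 (G : finGroupType) : {set {set G}} :=
  [set A : {set G} | (#|A| == 3) && [exists a, exists b, A == ap3 a b]].

Definition color : finType := seq_sub [:: (-1)%R; 1%R : int].

Definition color1 : color := SeqSub (isT : 1%R \in [:: (-1)%R; 1%R : int]).

Definition coloring (G : finGroupType) : finType := {ffun G -> color}.

Definition monochromatic (G : finGroupType) (chi : coloring G)
    (A : {set G}) : bool :=
  [forall x in A, forall y in A, chi x == chi y].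

Definition mono_AP3 (G : finGroupType) (chi : coloring G) : {set {set G}} :=
  [set A in AP3 G | monochromatic chi A].

(* The constant coloring only witnesses that there is a coloring to minimize
   over; the value does not depend on it. *)
Definition R32 (G : finGroupType) : nat :=
  #|mono_AP3 [arg min_(chi < [ffun=> color1] : coloring G) #|mono_AP3 chi|]|.

Definition elts_of_order (G : finGroupType) (k : nat) : {set G} :=
  [set x : G | #[x]%g == k].

Definition inK (N k : nat) : bool :=
  (5 <= k <= N) && (3 * k%:R / 4 <= (totient k)%:R :> rat)%R.

(* Main.v *)
(* A progression a, ba, bba comes from 2 pairs (a, b) if b has order at least 4,
   and from 6 pairs if b has order 3, which gives the total count.
   For the lower bound, put s = +-1 for the colour and
   f(b) = sum_x s(x) s(bx).  The number of a such that (a, b) is monochromatic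
   is (N + 2 f(b) + f(b^2)) / 4.  The sum of f over the cyclic group <b> is
   nonnegative, being a sum of squares over cosets, and each of its k - phi(k)
   non-generators contributes at most N; hence the generators contribute at
   least -(k - phi(k)) N.  If phi(k) >= 3k/4 then k is odd, so squaring permutes
   the elements of order k and the terms f(b^2) sum to the same as the f(b). *)

Require Import Defs.
From mathcomp Require Import all_boot all_order all_algebra all_fingroup.
From mathcomp Require Import cyclic zify ring lra.
Set Implicit Arguments.
Unset Strict Implicit.
Unset Printing Implicit Defensive.

Import Order.TTheory GRing.Theory Num.Theory.
Local Open Scope ring_scope.

(** * Pairs (start, step) that give the same progression *)

Section Progressions.

Context {G : finGroupType}.
Implicit Types (a b : G) (A : {set G}).

Lemma order_gt2 b : (2 < #[b]%g)%N = (b != 1%g) && (b * b != 1)%g.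
Proof.
rewrite -order_gt1 -[X in (X != 1)%g]/(b ^+ 2)%g -order_dvdn.
by case: #[b]%g (order_gt0 b) => [|[|[|n]]].
Qed.

Lemma order_eq3 b : (2 < #[b]%g)%N -> (#[b]%g == 3%N) = (b ^+ 3 == 1)%g.
Proof.
move=> b2; rewrite -order_dvdn; apply/eqP/idP => [-> //|/dvdn_leq].
by move: b2 => + /(_ isT); lia.
Qed.

(** Cancelling common factors turns the three conditions into [b != 1], [b * b != 1] and again
    [b != 1]. *)
Lemma ap3_distinct a b : (2 < #[b]%g)%N =
  [&& a != (b * a)%g, a != (b * b * a)%g & (b * a != b * b * a)%g].
Proof.
have e x : (a == x * a)%g = (x == 1)%g.
  by rewrite -{1}[a]mul1g (inj_eq (mulIg a)) eq_sym.
have -> : (b * a == b * b * a)%g = (b == 1)%g.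
  by rewrite -mulgA (inj_eq (mulgI b)) e.
by rewrite order_gt2 !e; case: (b == 1)%g; rewrite ?andbT ?andbF.
Qed.

Lemma card_ap3 a b : (#|ap3 a b| == 3%N) = (2 < #[b]%g)%N.
Proof.
rewrite /ap3 setUC cardsU1 cards2 !inE (ap3_distinct a) negb_or.
rewrite ![(b * b * a)%g == _]eq_sym.
by do 2!case: (a == _); case: (_ == (b * b * a)%g).
Qed.

Lemma ap3_powP a b x : reflect (exists2 i, (i < 3)%N & x = b ^+ i * a)%g
                               (x \in ap3 a b).
Proof.
rewrite /ap3 !inE -orbA; apply: (iffP or3P) => [[]/eqP->|[[|[|[|//]]] _ ->]].
- by exists 0%N; rewrite ?mul1g.
- by exists 1%N; rewrite ?expg1.
- by exists 2%N.
- by rewrite mul1g; apply: Or31.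
- by rewrite expg1; apply: Or32.
- exact: Or33.
Qed.

Lemma ap3_rev a b : ap3 (b * b * a)%g b^-1%g = ap3 a b.
Proof.
rewrite /ap3 -!mulgA !mulKg -[in RHS]setUA setUC; congr (_ :|: _).
by rewrite setUC.
Qed.

Lemma ap3_shift a b : (b ^+ 3 = 1)%g -> ap3 (b * a)%g b = ap3 a b.
Proof.
move=> b3; rewrite /ap3 !mulgA.
have -> : (b * b * b = 1)%g by rewrite -b3 !expgS expg0 mulg1 mulgA.
by rewrite mul1g setUC setUA.
Qed.

(* Writing the terms of the second progression as powers b^i a, b^j a, b^l a,
   with {i, j, l} = {0, 1, 2}, the progression condition is b^(i+l) = b^(2j):
   it always holds when j = 1, and means b^3 = 1 otherwise. *)
Lemma ap3_inj a b c d : (2 < #[d]%g)%N -> ap3 c d = ap3 a b ->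
  [\/ c = a /\ d = b, c = (b * b * a)%g /\ d = b^-1%g |
   (b ^+ 3 = 1)%g /\ exists i : 'I_3, c = (b ^+ i * a)%g /\
     (d = b \/ d = b^-1)%g].
Proof.
rewrite (ap3_distinct c) => /and3P[h1 h2 h3] E.
have /ap3_powP[i ilt ci] : c \in ap3 a b by rewrite -E !inE eqxx.
have /ap3_powP[j jlt cj] : (d * c)%g \in ap3 a b by rewrite -E !inE eqxx orbT.
have /ap3_powP[l llt cl] : (d * d * c)%g \in ap3 a b
  by rewrite -E !inE eqxx orbT.
have nij : i <> j by move=> e; rewrite cj -e -ci eqxx in h1.
have nil : i <> l by move=> e; rewrite cl -e -ci eqxx in h2.
have njl : j <> l by move=> e; rewrite cl -e -cj eqxx in h3.
have dE : (d * b ^+ i = b ^+ j)%g by apply: (mulIg a); rewrite -mulgA -ci.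
have dE' : (d * b ^+ j = b ^+ l)%g
  by apply: (mulIg a); rewrite -mulgA -cj mulgA.
(* Powers of [b] commute, so [d * b ^+ i * b ^+ j] can be evaluated in two ways. *)
have dE2 : (b ^+ (j + j) = b ^+ (l + i))%g.
  by rewrite expgD -{1}dE -mulgA -expgD addnC expgD mulgA dE' -expgD.
have dV : d = (b ^+ j * (b ^+ i)^-1)%g by rewrite -dE mulgK.
have b3V : (b ^+ 3 = 1 -> b * b = b^-1)%g.
  move=> b3; apply: (mulIg b); rewrite mulVg -b3.
  by rewrite !expgS expg0 mulg1 mulgA.
have b3P : (b ^+ (j + j) = b ^+ (l + i) -> j != 1%N -> b ^+ 3 = 1)%g.
  have [j0 e _|j0 e j1] := eqVneq j 0%N.
    have <- : (l + i = 3)%N by lia.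
    by rewrite -e j0.
  have [j2 li] : j = 2%N /\ (l + i = 1)%N by lia.
  move: e; rewrite j2 li (expgS b 3) expg1 => /eqP.
  by rewrite -{3}[b]mulg1 (inj_eq (mulgI b)) => /eqP.
have [j1|/(b3P dE2) b3] := eqVneq j 1%N.
  have [i0|i0] := eqVneq i 0%N.
    by apply: Or31; rewrite dV ci i0 j1 expg0 mul1g invg1 mulg1 expg1.
  have i2 : i = 2%N by lia.
  by apply: Or32; rewrite dV ci i2 j1 expg1 invMg mulKVg.
apply: Or33; split=> //; exists (Ordinal ilt); split=> //.
(* Exponents now count modulo 3: going from [i] to [j] adds 1, so [d = b], or subtracts 1, so
   [d = b^-1]. *)
have [e|e] := eqVneq ((i + 1) %% 3)%N j.
  left; rewrite dV -e; apply: (mulIg (b ^+ i)%g); rewrite mulgKV -expgS.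
  by rewrite (expg_mod _ b3) addn1.
have e2 : ((j + 1) %% 3)%N = i by lia.
by right; rewrite dV -e2 (expg_mod _ b3) addn1 expgS invMg mulKVg.
Qed.

(** The progression can only be read forwards or backwards: the third case of [ap3_inj] would force
    order 3. *)
Lemma ap3_fiber2 a b (p : G * G) : (3 < #[b]%g)%N ->
  (2 < #[p.2]%g)%N && (ap3 p.1 p.2 == ap3 a b) =
  (p \in [set (a, b); (b * b * a, b^-1)%g]).
Proof.
case: p => c d b3; have b2 := ltnW b3; rewrite !inE /=; apply/andP/orP.
  case=> d2 /eqP/(ap3_inj d2)[[-> ->]|[-> ->]|[/eqP e _]]; first by left.
    by right.
  by move: e b3; rewrite -order_eq3 // => /eqP->.
by case=> /eqP[-> ->]; rewrite ?orderV ?ap3_rev.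
Qed.

(** Here the progression is the right coset of [<[b]>] through [a], so any of its elements can start
    it, with step [b] or [b^-1]. *)
Lemma ap3_fiber6 a b (p : G * G) : #[b]%g = 3%N ->
  (2 < #[p.2]%g)%N && (ap3 p.1 p.2 == ap3 a b) =
  (p \in setX (ap3 a b) [set b; b^-1%g]).
Proof.
case: p => c d ob; have b2 : (2 < #[b]%g)%N by rewrite ob.
have b3 : (b ^+ 3 = 1)%g by apply/eqP; rewrite -order_eq3 ?ob.
have sh i : ap3 (b ^+ i * a)%g b = ap3 a b.
  by elim: i => [|i IH]; rewrite ?mul1g // expgS -mulgA ap3_shift.
(* Shifting the start once and then reversing moves it by [b ^+ 3 = 1] in total and inverts the
   step. *)
have shV x : ap3 x b^-1%g = ap3 x b.
  rewrite -[in RHS]ap3_shift // -[in RHS]ap3_rev !mulgA.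
  have -> : (b * b * b = 1)%g by rewrite -b3 !expgS expg0 mulg1 mulgA.
  by rewrite mul1g.
rewrite in_setX in_set2 /=; apply/andP/andP.
  case=> d2 /eqP E; split; first by rewrite -E !inE eqxx.
  by case: (ap3_inj d2 E) => [[_ ->]|[_ ->]|[_ [_ [_ []->]]]];
    rewrite eqxx ?orbT.
by case=> /ap3_powP[i _ ->] /orP[]/eqP->; rewrite ?orderV ?shV sh.
Qed.

End Progressions.

(** * Counting an image through its fibers *)

Section Fibers.

Context {T U : finType} (h : T -> U) (P : {set T}) (c : nat).

Lemma card_uniform_fibers :
  (forall x, x \in P -> #|[set y in P | h y == h x]| = c) ->
  #|P| = (c * #|h @: P|)%N.
Proof.
move=> H; rewrite -sum1_card (partition_big_imset h) /= mulnC -sum_nat_const.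
apply: eq_bigr => _ /imsetP[x xP ->]; rewrite sum1dep_card -(H x xP).
by apply: eq_card => y; rewrite !inE.
Qed.

Lemma card_bounded_fibers :
  (forall x, x \in P -> #|[set y in P | h y == h x]| <= c)%N ->
  (#|P| <= c * #|h @: P|)%N.
Proof.
move=> H; rewrite -sum1_card (partition_big_imset h) /= mulnC -sum_nat_const.
apply: leq_sum => _ /imsetP[x xP ->]; rewrite sum1dep_card.
apply: leq_trans (H x xP); apply: eq_leq.
by apply: eq_card => y; rewrite !inE.
Qed.

End Fibers.

(** * The number of progressions *)

Section Counting.

Context {G : finGroupType}.

Local Notation elts := (elts_of_order G).
Local Notation ap p := (ap3 p.1 p.2).

Lemma sum_by_order (Q : pred nat) (F : G -> rat) :
  \sum_(b | Q #[b]%g) F b = \sum_(k < #|G|.+1 | Q k) \sum_(b in elts k) F b.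
Proof.
(* [inord] keeps the value because the order of an element is at most [#|G|]. *)
have ord (b : G) : (inord #[b]%g : 'I_#|G|.+1) = #[b]%g :> nat.
  by rewrite inordK // ltnS; apply: max_card.
rewrite (partition_big (fun b => inord #[b]%g : 'I_#|G|.+1) (fun k => Q k)).
  apply: eq_bigr => k Qk; apply: eq_bigl => b; rewrite inE -val_eqE /= ord.
  by case: eqP => [->|]; rewrite ?Qk ?andbF.
by move=> b; rewrite ord.
Qed.

Lemma card_pairs_by_order (Q : pred nat) :
  #|[set p : G * G | Q #[p.2]%g]|%:R =
  \sum_(k < #|G|.+1 | Q k) #|G|%:R * #|elts k|%:R :> rat.
Proof.
have -> : [set p : G * G | Q #[p.2]%g] = setX setT [set b | Q #[b]%g].
  by apply/setP => p; rewrite !inE.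
rewrite cardsX cardsT natrM -mulr_sumr -[#|[set _ | _]|]sum1dep_card natr_sum.
rewrite sum_by_order; congr (_ * _); apply: eq_bigr => k _.
by rewrite -sum1_card natr_sum.
Qed.

(** The two images are separated because their fibers have different sizes, 2 and 6. *)
Lemma AP3_split : AP3 G =
  ((fun p : G * G => ap p) @: [set p | (3 < #[p.2]%g)%N]) :|:
  ((fun p : G * G => ap p) @: [set p | #[p.2]%g == 3%N]).
Proof.
apply/setP => A; rewrite inE; apply/andP/setUP.
  case=> A3 /existsP[a /existsP[b /eqP E]]; move: A3.
  rewrite E card_ap3 leq_eqVlt eq_sym => /orP[o|o]; [right|left];
  by apply/imsetP; exists (a, b); rewrite ?inE.
by case=> /imsetP[[a b]]; rewrite inE /= => o ->; rewrite card_ap3;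
  (split; first by move: o; lia); apply/existsP; exists a;
  apply/existsP; exists b.
Qed.

Lemma card_AP3 : #|AP3 G|%:R =
  \sum_(4 <= k < #|G|.+1) #|G|%:R * #|elts k|%:R / 2
  + #|G|%:R * #|elts 3|%:R / 6 :> rat.
Proof.
have fib2 (p : G * G) : p \in [set p : G * G | (3 < #[p.2]%g)%N] ->
    #|[set q in [set p : G * G | (3 < #[p.2]%g)%N] | ap q == ap p]| = 2%N.
  case: p => a b; rewrite inE /= => b3.
  have -> : [set q in [set p : G * G | (3 < #[p.2]%g)%N] | ap q == ap3 a b]
      = [set (a, b); (b * b * a, b^-1)%g].
    apply/setP => q; rewrite -ap3_fiber2 // !inE.
    (* [ap3_fiber2] only asks for order above 2; once the progressions agree, [q.2] is [b] or [b^-1]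
       and has the order of [b]. *)
    case: (leqP 3 #[q.2]%g) => [q2|q2]; last first.
      by have -> : (3 < #[q.2]%g)%N = false by lia.
    case E: (_ == _); rewrite ?andbF // !andbT.
    have := ap3_fiber2 a q b3; rewrite q2 E => /esym.
    by rewrite in_set2 => /orP[]/eqP->; rewrite /= ?orderV b3.
  rewrite cards2 xpair_eqE negb_and.
  suff -> : b != b^-1%g by rewrite orbT.
  by have := ltnW b3; rewrite order_gt2 [b == b^-1%g]eq_sym eq_invg_mul => /andP[].
have fib6 (p : G * G) : p \in [set p : G * G | #[p.2]%g == 3%N] ->
    #|[set q in [set p : G * G | #[p.2]%g == 3%N] | ap q == ap p]| = 6%N.
  case: p => a b; rewrite inE /= => /eqP b3.
  have b2 : (2 < #[b]%g)%N by rewrite b3.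
  have -> : [set q in [set p : G * G | #[p.2]%g == 3%N] | ap q == ap3 a b]
      = setX (ap3 a b) [set b; b^-1%g].
    apply/setP => q; rewrite -ap3_fiber6 // !inE.
    case: (leqP 3 #[q.2]%g) => [q2|q2]; last first.
      by have -> : (#[q.2]%g == 3%N) = false by lia.
    case E: (_ == ap3 a b); rewrite ?andbF // !andbT.
    have := ap3_fiber6 a q b3; rewrite q2 E => /esym.
    case: q {q2 E} => c d.
    by rewrite in_setX in_set2 => /andP[_ /orP[]/eqP->]; rewrite ?orderV b3.
  rewrite cardsX cards2; have /eqP-> : #|ap3 a b| == 3%N by rewrite card_ap3.
  suff -> : b != b^-1%g by [].
  by move: b2; rewrite order_gt2 [b == b^-1%g]eq_sym eq_invg_mul => /andP[].
have /(congr1 (fun n => n%:R : rat)) := card_uniform_fibers fib2.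
have /(congr1 (fun n => n%:R : rat)) := card_uniform_fibers fib6.
rewrite (card_pairs_by_order (fun k => k == 3%N)).
rewrite (card_pairs_by_order (fun k => 3 < k)%N) !natrM => E6 E2.
rewrite AP3_split cardsU; set X := _ @: _ in E2 *; set Y := _ @: _ in E6 *.
(* If a progression has a step of order above 3, its only other step is the inverse, so none of
   order 3 occurs. *)
have -> : X :&: Y = set0.
  apply/setP => A; rewrite !inE; apply/andP => -[/imsetP[[a b]]].
  rewrite inE /= => b3 -> /imsetP[[c d]]; rewrite inE /= => /eqP d3 E.
  have := ap3_fiber2 a (c, d) b3; rewrite /= d3 E eqxx => /esym.
  by rewrite !inE => /orP[]/eqP[_ e]; move: b3 d3; rewrite e ?orderV => + d3;
    rewrite d3.
rewrite cards0 subn0 natrD -mulr_suml big_geq_mkord /=.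
have -> : \sum_(i < #|G|.+1 | (3 < i)%N) (#|G|%:R * #|elts i|%:R)
  = 2 * #|X|%:R :> rat by [].
have -> : #|G|%:R * #|elts 3|%:R = 6 * #|Y|%:R :> rat.
  (* If [#|G| < 3], the index 3 is out of range and no element has order 3, so both sides vanish. *)
  rewrite -E6; case: (ltnP 3 #|G|.+1) => [lt3|ge3].
    by rewrite (big_pred1 (Ordinal lt3)).
  rewrite big_pred0.
    have -> : elts 3 = set0.
      apply/setP => b; rewrite !inE; apply/eqP => b3; move: ge3.
      by rewrite -b3 ltnNge max_card.
    by rewrite cards0 mulr0.
  by move=> i; apply/eqP; have := ltn_ord i; move: ge3; lia.
by field.
Qed.

End Counting.

(** * Totients and parity *)

Lemma totient_even k : (0 < k)%N -> ~~ odd k -> (2 * totient k <= k)%N.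
Proof.
(* Write [k = m * 2 ^ l] with [m] odd and [l > 0]; the totient is that of [m] times [2 ^ l.-1]. *)
move=> k0 ek; have [m cm e] := pfactor_coprime (isT : prime 2) k0.
have l0 : (0 < logn 2 k)%N.
  by rewrite logn_gt0 mem_primes k0 dvdn2 ek.
have tm : (totient m <= m)%N.
  rewrite totient_count_coprime big_mkord -[X in (_ <= X)%N]card_ord -sum1_card.
  by apply: leq_sum => i _; case: coprime.
rewrite {1}e totient_coprime ?coprimeXr 1?coprime_sym // totient_pfactor //.
by rewrite mul1n mulnCA -expnS prednK // {2}e leq_mul2r tm orbT.
Qed.

Lemma inK_odd N k : inK N k -> odd k.
Proof.
case/andP=> /andP[k5 _] hk; apply: contraLR hk => ek.
have k0 : (0 < k)%N by lia.
have : (2 * totient k)%:R <= k%:R :> rat by rewrite ler_nat totient_even.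
have : 0 < k%:R :> rat by rewrite ltr0n.
by rewrite natrM -ltNge; lra.
Qed.

(** * Correlations of a coloring *)

Section Colorings.

Context {G : finGroupType} (chi : coloring G).
Implicit Types (a b d x : G) (k : nat).

Local Notation elts := (elts_of_order G).

Definition sgn x : rat := (ssval (chi x))%:~R.

(** This is the function [f] of the opening comment, an autocorrelation under left translation. *)
Definition corr b : rat := \sum_x sgn x * sgn (b * x)%g.

Lemma sgnP x : sgn x = 1 \/ sgn x = -1.
Proof.
by rewrite /sgn; have := ssvalP (chi x); rewrite !inE => /orP[]/eqP->;
  [right|left].
Qed.

Lemma sgn_eq x y : (chi x == chi y) = (sgn x == sgn y).
Proof. by rewrite /sgn eqr_int. Qed.

Lemma monochromatic_ap3 a b : monochromatic chi (ap3 a b) =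
  (chi a == chi (b * a)%g) && (chi (b * a)%g == chi (b * b * a)%g).
Proof.
apply/forall_inP/andP => [H|[/eqP e1 /eqP e2] x].
  have sub x y : x \in ap3 a b -> y \in ap3 a b -> chi x == chi y.
    by move=> /H/forall_inP; apply.
  by split; apply: sub; rewrite !inE eqxx ?orbT.
rewrite !inE -!orbA => Hx; apply/forall_inP => y; rewrite !inE -!orbA.
have E z : [|| z == a, z == (b * a)%g | z == (b * b * a)%g] ->
    chi z = chi a by case/or3P => /eqP->; rewrite -?e2 -?e1.
by move/E->; rewrite (E _ Hx).
Qed.

(** The three pairwise products of signs sum to 3 if all signs agree and to -1 otherwise. *)
Lemma monochromatic_sgn a b : (monochromatic chi (ap3 a b))%:R =
  (1 + sgn a * sgn (b * a)%g + sgn (b * a)%g * sgn (b * b * a)%g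
   + sgn a * sgn (b * b * a)%g) / 4 :> rat.
Proof.
rewrite monochromatic_ap3 !sgn_eq.
by case: (sgnP a) => ->; case: (sgnP (b * a)%g) => ->;
  case: (sgnP (b * b * a)%g) => ->.
Qed.

Lemma sum_monochromatic b :
  \sum_a (monochromatic chi (ap3 a b))%:R =
  (#|G|%:R + 2 * corr b + corr (b * b)%g) / 4 :> rat.
Proof.
under eq_bigr do rewrite monochromatic_sgn.
rewrite -mulr_suml !big_split /= sumr_const -/(corr (b * b)%g) -/(corr b).
have -> : \sum_a sgn (b * a)%g * sgn (b * b * a)%g = corr b.
  rewrite [RHS](reindex_inj (mulgI b)).
  by apply: eq_bigr => x _; rewrite mulgA.
by congr (_ / _); ring.
Qed.

Lemma corr_le b : corr b <= #|G|%:R.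
Proof.
rewrite -sum1_card natr_sum; apply: ler_sum => x _.
by case: (sgnP x) => ->; case: (sgnP (b * x)%g) => ->.
Qed.

(** After multiplication by [#|H|] the sum becomes a sum over [x] of squared sign sums on the cosets
    [H x]. *)
Lemma sum_corr_ge0 (H : {group G}) : 0 <= \sum_(d in H) corr d.
Proof.
rewrite -(pmulr_rge0 _ (_ : 0 < #|H|%:R)) ?ltr0n ?cardG_gt0 //.
suff -> : #|H|%:R * \sum_(d in H) corr d =
    \sum_x (\sum_(h in H) sgn (h * x)%g) ^+ 2.
  by apply: sumr_ge0 => x _; apply: sqr_ge0.
rewrite mulr_natl -sumr_const.
transitivity (\sum_(h in H) \sum_x \sum_(d in H)
    sgn (h * x)%g * sgn (d * x)%g); last first.
  rewrite exchange_big; apply: eq_bigr => x _ /=; rewrite expr2 mulr_suml.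
  by apply: eq_bigr => h _; rewrite mulr_sumr.
(* For fixed [h] in [H], replace [d] by [d * h] on the right and [x] by [h * x] inside [corr d]. *)
apply: eq_bigr => h hH; rewrite [RHS]exchange_big /=.
rewrite [RHS](reindex_inj (mulIg h)) /=.
apply: eq_big => [d|d _]; first by rewrite groupMr.
rewrite /corr (reindex_inj (mulgI h)) /=.
by apply: eq_bigr => x _; rewrite mulgA.
Qed.

Lemma sum_generators_corr b :
  - ((#[b]%g%:R - (totient #[b]%g)%:R) * #|G|%:R) <=
  \sum_(d | generator <[b]> d) corr d.
Proof.
have := sum_corr_ge0 <[b]>%G.
have gen_in d : generator <[b]>%g d -> d \in <[b]>%g.
  by move/eqP->; apply: cycle_id.
rewrite (bigID (generator <[b]>%g)) /=.
have -> : \sum_(d in <[b]>%g | generator <[b]>%g d) corr d =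
    \sum_(d | generator <[b]>%g d) corr d.
  by apply: eq_bigl => d; case g: generator; rewrite ?andbF // (gen_in _ g).
suff : \sum_(d in <[b]>%g | ~~ generator <[b]>%g d) corr d <=
    (#[b]%g%:R - (totient #[b]%g)%:R) * #|G|%:R by lra.
apply: (@le_trans _ _ (\sum_(d in <[b]>%g | ~~ generator <[b]>%g d) #|G|%:R)).
  by apply: ler_sum => d _; apply: corr_le.
rewrite sumr_const -[X in X <= _]mulr_natl; apply: ler_wpM2r; first exact: ler0n.
rewrite totient_gen lerBrDr -natrD ler_nat /order addnC.
rewrite -[X in (_ <= X)%N](cardID (generator <[b]>%g)).
apply: leq_add; apply: eq_leq; apply: eq_card => d; rewrite !inE; last first.
  by rewrite andbC unfold_in.
by rewrite andb_idl //; apply: gen_in.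
Qed.

Lemma elts_generator k b d : #[b]%g = k ->
  (d \in elts k) && generator <[d]> b = generator <[b]> d.
Proof.
move=> bk; rewrite /generator inE [RHS]eq_sym andb_idl // => /eqP e.
by rewrite -bk /order e.
Qed.

(* Summing the previous bound over b of order k counts each d of order k once
   for each of the totient k generators b of <[d]>. *)
Lemma sum_elts_corr k : (0 < k)%N ->
  - (#|G|%:R * #|elts k|%:R * ((k%:R - (totient k)%:R) / (totient k)%:R)) <=
  \sum_(b in elts k) corr b.
Proof.
move=> k0; have t0 : 0 < (totient k)%:R :> rat by rewrite ltr0n totient_gt0.
rewrite -(ler_pM2l t0).
have -> : (totient k)%:R * \sum_(b in elts k) corr b =
    \sum_(b in elts k) \sum_(d | generator <[b]>%g d) corr d.
  rewrite [RHS](exchange_big_dep (mem (elts k))) /=; last first.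
    move=> b d; rewrite !inE /generator => /eqP <- /eqP e.
    by rewrite /order e.
  rewrite mulr_sumr; apply: eq_bigr => d; rewrite inE => /eqP dk.
  rewrite sumr_const mulr_natl; congr (_ *+ _).
  rewrite -dk totient_gen; apply: eq_card => b.
  by rewrite inE -(elts_generator b (erefl #[d]%g)).
apply: le_trans (_ : \sum_(b in elts k)
    - ((k%:R - (totient k)%:R) * #|G|%:R) <= _); last first.
  apply: ler_sum => b; rewrite inE => /eqP <-.
  exact: sum_generators_corr.
rewrite sumr_const -[X in _ <= X]mulr_natl le_eqVlt; apply/orP; left; apply/eqP.
by field; apply: lt0r_neq0.
Qed.

Lemma sum_elts_corr_sqr k : odd k ->
  \sum_(b in elts k) corr (b * b)%g = \sum_(b in elts k) corr b.
Proof.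
move=> ok; have ord b : #[b]%g = k -> #[b * b]%g = k.
  move=> bk; rewrite -[(b * b)%g]/(b ^+ 2)%g orderXgcd bk.
  by have /eqP-> : coprime k 2; rewrite ?coprimen2 ?divn1.
have inj : {in elts k &, injective (fun b => b * b)%g}.
  move=> b c; rewrite !inE => /eqP bk /eqP ck e.
  (* For odd [k], [k./2.+1] is [(k + 1) / 2], the inverse of 2 modulo [k], so this power undoes
     squaring. *)
  have pw d : #[d]%g = k -> ((d * d) ^+ k./2.+1 = d)%g.
    move=> dk; rewrite -[(d * d)%g]/(d ^+ 2)%g -expgM.
    have -> : (2 * k./2.+1 = k + 1)%N by have := odd_double_half k; rewrite ok; lia.
    by rewrite expgD -dk expg_order mul1g.
  by rewrite -(pw b bk) -(pw c ck) e.
have im : (fun b => b * b)%g @: elts k = elts k.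
  apply/eqP; rewrite eqEcard (card_in_imset inj) leqnn andbT.
  by apply/subsetP => _ /imsetP[b + ->]; rewrite !inE => /eqP/ord->.
by rewrite -[in RHS]im big_imset.
Qed.

Lemma mono_AP3_lower_bound :
  \sum_(k < #|G|.+1 | inK #|G| k) #|G|%:R * #|elts k|%:R / 8 *
    (1 - 3 * ((k%:R - (totient k)%:R) / (totient k)%:R))
  <= #|mono_AP3 chi|%:R :> rat.
Proof.
pose M := [set p : G * G | inK #|G| #[p.2]%g && monochromatic chi (ap3 p.1 p.2)].
pose h (p : G * G) := ap3 p.1 p.2.
have k5 k : inK #|G| k -> (4 < k)%N by case/andP=> /andP[].
have hM : (#|h @: M| <= #|mono_AP3 chi|)%N.
  apply: subset_leq_card; apply/subsetP => _ /imsetP[[a b] + ->].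
  rewrite !inE /= => /andP[/k5 b5 ->]; rewrite card_ap3 andbT.
  apply/andP; split; first exact: leq_trans b5.
  by apply/existsP; exists a; apply/existsP; exists b.
have M2 : (#|M| <= 2 * #|h @: M|)%N.
  apply: card_bounded_fibers => -[a b]; rewrite inE /= => /andP[/k5 b5 _].
  apply: (@leq_trans #|[set (a, b); (b * b * a, b^-1)%g]|); last first.
    by rewrite cards2; case: (_ != _).
  apply: subset_leq_card; apply/subsetP => q.
  rewrite inE -ap3_fiber2; last by lia.
  by rewrite inE -andbA => /and3P[/k5 q5 _ ->]; rewrite andbT; lia.
have {M2 hM} : #|M|%:R <= 2 * #|mono_AP3 chi|%:R :> rat.
  by rewrite -natrM ler_nat (leq_trans M2) // leq_mul2l hM.
(* Fibers of size at most 2 turn the denominator 8 into the 4 of [sum_monochromatic]. *)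
suff : \sum_(k < #|G|.+1 | inK #|G| k) #|G|%:R * #|elts k|%:R / 4 *
    (1 - 3 * ((k%:R - (totient k)%:R) / (totient k)%:R)) <= #|M|%:R :> rat.
  set S := (X in X <= _) => SM M2; set S' := (X in X <= _).
  suff -> : S' = S / 2 by lra.
  by rewrite /S mulr_suml; apply: eq_bigr => k _; set r := _ / (totient k)%:R; field.
have -> : #|M|%:R = \sum_(b | inK #|G| #[b]%g)
    \sum_a (monochromatic chi (ap3 a b))%:R :> rat.
  rewrite -sum1dep_card natr_sum (eq_bigl (fun p : G * G => inK #|G| #[p.2]%g &&
    monochromatic chi (ap3 p.1 p.2))) // big_mkcondr /=.
  rewrite exchange_big pair_big_dep /=.
  by apply: eq_bigr => p _; case: monochromatic.
rewrite (sum_by_order (inK #|G|)); apply: ler_sum => k kK.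
under eq_bigr do rewrite sum_monochromatic.
(* The sum of [corr (b * b)] joins twice the sum of [corr b], which is where the factor 3 comes
   from. *)
rewrite -mulr_suml !big_split /= -mulr_sumr sum_elts_corr_sqr ?(inK_odd kK) //.
rewrite sumr_const -[_ *+ #|_|]mulr_natr.
have := @sum_elts_corr k (ltnW (ltnW (ltnW (ltnW (k5 _ kK))))).
by set r := (_ - _) / _; set c := \sum_(_ in _) _; lra.
Qed.

End Colorings.

Theorem theorem1 (G : finGroupType) :
  let N : rat := #|G|%:R in
  let N_ (k : nat) : rat := #|elts_of_order G k|%:R in
  let phi (k : nat) : rat := (totient k)%:R in
  #|AP3 G|%:R = \sum_(4 <= k < #|G|.+1) N * N_ k / 2 + N * N_ 3%N / 6
  /\ \sum_(k < #|G|.+1 | inK #|G| k)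
       N * N_ k / 8 * (1 - 3 * ((k%:R - phi k) / phi k))
     <= (R32 G)%:R.
Proof.
(* The bound holds for every coloring, in particular for the minimizer chosen in [R32]. *)
by move=> N N_ phi; split; [apply: card_AP3 | apply: mono_AP3_lower_bound].
Qed.
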